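(* Let $\mathcal X\subset\mathbb R^d$ be a finite set with Euclidean distance $d$, and let $C=\{C_1,\dots,C_k\}$ be a center-based clustering of $\mathcal X$ satisfying the $\gamma$-margin property, where the center $\mu_i$ of $C_i$ is its center of mass $\frac1{|C_i|}\sum_{x\in C_i}x$. Assume $\delta\in(0,1)$ and $\gamma>1$. Then with probability at least $1-\delta$, the algorithm described in the context, run with a $C$-oracle, outputs $C$ (as a partition of $\mathcal X$).
   Context: A clustering $C=\{C_1,\dots,C_k\}$ is center-based with centers $\mu_1,\dots,\mu_k$ if $x\in C_i\iff i=\arg\min_j d(x,\mu_j)$. It satisfies the $\gamma$-margin property if for all $i$, all $x\in C_i$, $y\in\mathcal X\setminus C_i$: $\gamma d(x,\mu_i)<d(y,\mu_i)$. A $C$-oracle answers same-cluster queries ($\mathcal O(x_1,x_2)$ = true iff $x_1,x_2$ lie in the same cluster of $C$) and cluster-assignment queries ($\mathcal O(x)=i$ iff $x\in C_i$). The algorithm (input $\mathcal X$, oracle, $k$, $\delta$; $\gamma$ known) sets $S_1=\mathcal X$, output $\mathcal C=\emptyset$, and $\eta=\beta\frac{\log k+\log(1/\delta)}{(\gamma-1)^4}$, where $\beta$ is a fixed absolute constant (the constant of a generalized Hoeffding inequality for bounded i.i.d. random vectors in a Hilbert space). For $i=1,\dots,k$: Phase 1: draw $l=k\eta+1$ elements $Z$ independently and uniformly at random from $S_i$; ask a cluster-assignment query for each; let $Z_t=\{x\in Z:\mathcal O(x)=t\}$, $p=\arg\max_t|Z_t|$, and $\mu_p'=\frac1{|Z_p|}\sum_{x\in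 Z_p}x$. Phase 2: sort $S_i$ in increasing order of $d(x,\mu_p')$ and, by binary search using same-cluster queries, find the radius $r_i$ such that the elements of $S_i$ in cluster $p$ are exactly those with $d(x,\mu_p')\le r_i$ (assuming such a radius exists); set $C_p'=\{x\in S_i: d(x,\mu_p')\le r_i\}$, $S_{i+1}=S_i\setminus C_p'$, $\mathcal C=\mathcal C\cup\{C_p'\}$. Output $\mathcal C$. *)

(* Defs.v *)
From HB Require Import structures.
From mathcomp Require Import all_boot all_order all_algebra.
From mathcomp Require Import boolp reals exp.
Set Implicit Arguments. Unset Strict Implicit. Unset Printing Implicit Defensive.
Import Order.TTheory GRing.Theory Num.Theory.
Local Open Scope ring_scope.

Section ActiveKMeans.
Variables (R : realType) (d : nat).

Definition edist (x y : 'rV[R]_d) : R :=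
  Num.sqrt (\sum_(j < d) (x 0 j - y 0 j) ^+ 2).

Variables (T : finType) (pts : T -> 'rV[R]_d) (k : nat) (cl : T -> 'I_k).
(* The finite data set is X = image of pts (pts injective);
   cluster C_i = [set x | cl x == i]; the C-oracle answers cl. *)

Definition cluster (i : 'I_k) : {set T} := [set x | cl x == i].

Definition com (i : 'I_k) : 'rV[R]_d :=
  (#|cluster i|%:R)^-1 *: \sum_(x in cluster i) pts x.

Definition center_based (mu : 'I_k -> 'rV[R]_d) : Prop :=
  forall (x : T) (i : 'I_k),
    cl x = i <-> (forall j : 'I_k, j != i -> edist (pts x) (mu i) < edist (pts x) (mu j)).

Definition gamma_margin (gamma : R) (mu : 'I_k -> 'rV[R]_d) : Prop :=
  forall (i : 'I_k) (x y : T), cl x = i -> cl y != i ->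
    gamma * edist (pts x) (mu i) < edist (pts y) (mu i).

Definition target : {set {set T}} := [set cluster i | i in 'I_k].

Variable l : nat.

(* Phase 1 + Phase 2 of one iteration, given the sample Z (drawn from S).
   Returns None when the algorithm fails (radius r_i of Phase 2 does not exist). *)
Definition one_step (S : {set T}) (Z : l.+1.-tuple T) : option {set T} :=
  let cnt := fun t : 'I_k => count (fun x => cl x == t) Z in
  let p := [arg max_(t > cl (tnth Z ord0)) cnt t]%O in
  let mu' := ((cnt p)%:R)^-1 *: \sum_(x <- Z | cl x == p) pts x in
  let Cp := [set x in S | cl x == p] in
  if asbool (exists r : R, Cp = [set x in S | edist (pts x) mu' <= r])
  then Some Cp else None.

(* Exact probability that the remaining [n] iterations, started from the
   remaining set S and current output acc, end with output equal to [target];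
   each iteration draws l.+1 elements of S independently and uniformly. *)
Fixpoint success_prob (n : nat) (S : {set T}) (acc : {set {set T}}) : R :=
  match n with
  | 0 => if acc == target then 1 else 0
  | n'.+1 =>
      if S == set0 then 0 else
      (#|S|%:R ^+ l.+1)^-1 *
      \sum_(Z : l.+1.-tuple T | all (fun x => x \in S) Z)
         match one_step S Z with
         | Some Cp => success_prob n' (S :\: Cp) (Cp |: acc)
         | None => 0
         end
  end.

End ActiveKMeans.

Definition eta_nat (R : realType) (beta gamma delta : R) (k : nat) : nat :=
  `|Num.ceil (beta * (ln (k%:R) + ln (delta^-1)) / (gamma - 1) ^+ 4)|%N.

(* Probability that the algorithm outputs C; l = k * eta + 1 samples per round. *)
Definition algo_success_prob (R : realType) (d : nat) (T : finType)
  (pts : T -> 'rV[R]_d) (k : nat) (cl : T -> 'I_k) (beta gamma delta : R) : R :=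
  success_prob pts cl (k * eta_nat beta gamma delta k) k [set: T] set0.

(* Main.v *)
(* If the sampled mean of the plurality cluster p is within (gamma - 1) D / 2 of
   the true center, D being the radius of C_p, then by the margin property a ball
   around it separates C_p from the other clusters, so the round returns C_p.  By
   pigeonhole p was sampled more than eta times, hence for gamma < 3 a failure
   forces a sum of more than eta centered vectors of norm at most D to be large.
   This is controlled by a dimension-free martingale bound: for centered V with
   |V| <= h, E cosh |s + V| <= cosh |s| cosh h, because cosh is convex as a
   function of the square.  Applied to every cluster t separately, with the
   samples outside C_t contributing 0, it needs no conditioning on the labels; the
   factor k of the union bound is absorbed by taking beta = 384, which makes each
   tail at most 2 (delta / k)^3.  For gamma >= 3 or k <= 1 no round ever fails. *)

From mathcomp Require Import classical_sets sequences topology normedtype.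
From mathcomp Require Import ring lra.
(* Imported after [normedtype], which has an [edist] of its own. *)
Require Import Defs.
From HB Require Import structures.
From mathcomp Require Import all_boot all_order all_algebra.
From mathcomp Require Import boolp reals exp.
Set Implicit Arguments. Unset Strict Implicit. Unset Printing Implicit Defensive.
Import Order.TTheory GRing.Theory Num.Theory.
Import numFieldNormedType.Exports.
Local Open Scope ring_scope.

(** * Hyperbolic cosine: growth and convexity in the square *)

Section HyperbolicCosine.
Variable R : realType.
Implicit Types a b c p q u v w x y : R.

Definition cosh x : R := (expR x + expR (- x)) / 2.

Lemma coshN x : cosh (- x) = cosh x.
Proof. by rewrite /cosh opprK addrC. Qed.

Lemma cosh_ge0 x : 0 <= cosh x.
Proof. by rewrite divr_ge0// addr_ge0// expR_ge0. Qed.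

Lemma cosh_gt0 x : 0 < cosh x.
Proof. by rewrite divr_gt0// addr_gt0// expR_gt0. Qed.

Lemma cosh0 : cosh 0 = 1.
Proof. by rewrite /cosh oppr0 expR0; field. Qed.

Lemma expR_le_cosh x : expR x / 2 <= cosh x.
Proof. by rewrite ler_pM2r ?invr_gt0// lerDl expR_ge0. Qed.

(** For [x >= 1 / 2], already [expR x] is below the bound; for smaller [x >= 0], the inequalities
    [expR x * (1 - x) <= 1] and [expR (- x) * (1 + x) <= 1] give [cosh x * (1 - x ^+ 2) <= 1]. *)
Lemma cosh_le_expR_sqr x : cosh x <= expR (2 * x ^+ 2).
Proof.
wlog x0 : x / 0 <= x.
  move=> H; have [/H//|x0] := leP 0 x.
  by rewrite -coshN -[x ^+ 2]sqrrN; apply: H; lra.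
have e0 := expR_gt0 x.
have [x2|x2] := leP (1 / 2) x.
  apply: (@le_trans _ _ (expR x)); last by rewrite ler_expR; nra.
  have : expR (- x) <= expR x by rewrite ler_expR; lra.
  by rewrite /cosh; lra.
have h1 := expR_ge1Dx x; have h2 := expR_ge1Dx (- x).
have h3 := expR_ge1Dx (2 * x ^+ 2).
have h12 := expRxMexpNx_1 x.
have f0 := expR_gt0 (- x).
have hm : cosh x * (1 - x ^+ 2) <= 1.
  rewrite /cosh; have : expR x * (1 - x) <= 1 by nra.
  have : expR (- x) * (1 + x) <= 1 by nra.
  by nra.
have : (1 + 2 * x ^+ 2) * (1 - x ^+ 2) >= 1.
  have: x ^+ 2 <= 1/4 by nra.
  have: 0 <= x ^+ 2 by nra.
  nra.
have : 0 < 1 - x ^+ 2 by nra.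
have := cosh_gt0 x; nra.
Qed.

(** The loss in the induction step is [a * b * (x - y) * (x ^+ n - y ^+ n)], whose last two factors
    never have opposite signs. *)
Lemma convex_exprn a b x y n : 0 <= a -> 0 <= b -> a + b = 1 ->
  0 <= x -> 0 <= y -> (a * x + b * y) ^+ n <= a * x ^+ n + b * y ^+ n.
Proof.
move=> a0 b0 ab x0 y0; elim: n => [|n IH]; first by rewrite !expr0; lra.
have xy0 : 0 <= a * x + b * y by rewrite addr_ge0// mulr_ge0.
rewrite exprS; apply: (le_trans (ler_wpM2l xy0 IH)); rewrite !exprS.
have : 0 <= (x - y) * (x ^+ n - y ^+ n).
  have [xy|/ltW xy] := leP x y.
    by rewrite mulr_le0// subr_le0// lerXn2r.
  by rewrite mulr_ge0// subr_ge0// lerXn2r.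
move: (x ^+ n) (y ^+ n) => X Y h.
have -> : b = 1 - a by lra.
have : 0 <= a * (1 - a) * ((x - y) * (X - Y)).
  by rewrite mulr_ge0// mulr_ge0//; lra.
lra.
Qed.

Let coshs x : nat -> R := fun n =>
  series (exp_coeff x) n + series (exp_coeff (- x)) n.

Let coshs_cvg x : (coshs x @ \oo --> 2 * cosh x)%classic.
Proof.
rewrite /cosh mulrC divfK ?pnatr_eq0//.
by apply: cvgD; exact: is_cvg_series_exp_coeff.
Qed.

(* The power series of cosh involves only powers of the square. *)
Lemma cosh_convex_sqr a b u v w : 0 <= a -> 0 <= b -> a + b = 1 ->
  w ^+ 2 = a * u ^+ 2 + b * v ^+ 2 -> cosh w <= a * cosh u + b * cosh v.
Proof.
move=> a0 b0 ab wE; rewrite -(@ler_pM2l _ 2)//.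
have -> : 2 * (a * cosh u + b * cosh v) = a * (2 * cosh u) + b * (2 * cosh v).
  by ring.
apply: (@ler_cvg_to _ (\oo)%classic _ _ (coshs w)
  (fun n => a * coshs u n + b * coshs v n)).
- exact: coshs_cvg.
- by apply: cvgD; apply: cvgMl_tmp; exact: coshs_cvg.
- apply: nearW => n.
  have sE x : coshs x n = \sum_(0 <= i < n) (x ^+ i + (- x) ^+ i) / i`!%:R.
    rewrite /coshs /series /= -big_split /=.
    by apply: eq_bigr => i _; rewrite /exp_coeff/= mulrDl.
  rewrite !sE !mulr_sumr -big_split /=; apply: ler_sum => i _.
  rewrite !mulrA -mulrDl ler_wpM2r ?invr_ge0//.
  rewrite (exprNn w) (exprNn u) (exprNn v) -signr_odd; have [oi|ei] := boolP (odd i).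
    by rewrite expr1 !mulN1r !subrr; lra.
  rewrite expr0 !mul1r -(odd_double_half i) (negbTE ei) add0n -mul2n !exprM.
  by have := convex_exprn i./2 a0 b0 ab (sqr_ge0 u) (sqr_ge0 v); rewrite -wE; lra.
Qed.

Lemma cosh_ge1 x : 1 <= cosh x.
Proof.
by have := expR_ge1Dx x; have := expR_ge1Dx (- x); rewrite /cosh; lra.
Qed.

(** [x ^+ 2] is a convex combination of [y ^+ 2] and [0 ^+ 2], and [cosh 0 = 1] is the minimum of
    [cosh]. *)
Lemma ler_cosh x y : 0 <= x -> x <= y -> cosh x <= cosh y.
Proof.
move=> x0 xy; have [y0|y0] := eqVneq y 0.
  by have -> : x = y by lra.
have y2 : 0 < y ^+ 2 by rewrite exprn_gt0// lt_neqAle eq_sym y0; lra.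
have a0 : 0 <= x ^+ 2 / y ^+ 2 by rewrite divr_ge0// sqr_ge0.
have a1 : x ^+ 2 / y ^+ 2 <= 1 by rewrite ler_pdivrMr// mul1r lerXn2r// nnegrE; lra.
have := @cosh_convex_sqr (x ^+ 2 / y ^+ 2) (1 - x ^+ 2 / y ^+ 2) y 0 x.
move=> h; apply: (le_trans (h _ _ _ _)); [lra|lra|lra| |].
  by rewrite divfK ?gt_eqF//; lra.
by rewrite cosh0; have := cosh_ge1 y; nra.
Qed.

(* The chord of [c |-> cosh (sqrt (p^2 + 2c + q^2))] over [-pq, pq]. *)
Lemma cosh_chord p q : exists K : R, forall c w, `|c| <= p * q ->
  w ^+ 2 = p ^+ 2 + 2 * c + q ^+ 2 -> cosh w <= cosh p * cosh q + K * c.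
Proof.
have E : cosh p * cosh q = (cosh (p + q) + cosh (p - q)) / 2.
  by rewrite /cosh !opprD opprK !expRD; field.
(* Slope of the chord: at the ends of the interval, [w] is [p + q] or [p - q] up to sign. When
   [p * q = 0] the slope is 0, as [0^-1 = 0]. *)
exists ((cosh (p + q) - cosh (p - q)) / (2 * (p * q))) => c w cpq wE.
have [pq0|pq0] := eqVneq (p * q) 0.
  have c0 : c = 0 by apply/eqP; rewrite -normr_le0 -pq0.
  rewrite pq0 !mulr0 invr0 !mulr0 mul0r addr0 E.
  have := @cosh_convex_sqr (1/2) (1/2) (p + q) (p - q) w.
  suff: w ^+ 2 = 1 / 2 * (p + q) ^+ 2 + 1 / 2 * (p - q) ^+ 2.
    by move=> + h => /h {}h; apply: le_trans (h _ _ _) _; lra.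
  by rewrite wE c0; lra.
have pq : 0 < p * q.
  by rewrite lt_neqAle eq_sym pq0 (le_trans _ cpq).
move: cpq; rewrite ler_norml => /andP[c1 c2].
pose t := c / (p * q).
have t1 : -1 <= t by rewrite ler_pdivlMr//; lra.
have t2 : t <= 1 by rewrite ler_pdivrMr//; lra.
have cE : c = t * (p * q) by rewrite divfK.
have := @cosh_convex_sqr ((1 + t)/2) ((1 - t)/2) (p + q) (p - q) w.
move=> h; apply: (le_trans (h _ _ _ _)); [lra|lra|lra|by rewrite wE cE; field|].
rewrite E le_eqVlt; apply/orP; left; apply/eqP; rewrite /t; field.
by move: pq0; rewrite mulf_eq0 negb_or => /andP[-> ->].
Qed.

End HyperbolicCosine.

(** * Euclidean inner product and norm *)

Section EuclideanNorm.
Variables (R : realType) (d : nat).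
Implicit Types (u v w : 'rV[R]_d) (a : R).

Definition dot u v : R := \sum_(j < d) u 0 j * v 0 j.

Definition nrm u : R := Num.sqrt (dot u u).

Lemma dotC u v : dot u v = dot v u.
Proof. by apply: eq_bigr => j _; rewrite mulrC. Qed.

Lemma dotDl u v w : dot (u + v) w = dot u w + dot v w.
Proof. by rewrite -big_split; apply: eq_bigr => j _; rewrite mxE mulrDl. Qed.

Lemma dotZl a u v : dot (a *: u) v = a * dot u v.
Proof. by rewrite mulr_sumr; apply: eq_bigr => j _; rewrite mxE mulrA. Qed.

Lemma dot0l u : dot 0 u = 0.
Proof. by rewrite -(scale0r 0) dotZl mul0r. Qed.

Lemma dotDr u v w : dot u (v + w) = dot u v + dot u w.
Proof. by rewrite dotC dotDl (dotC v) (dotC w). Qed.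

Lemma dotZr a u v : dot u (a *: v) = a * dot u v.
Proof. by rewrite dotC dotZl dotC. Qed.

Lemma dot_sumr (I : finType) (P : pred I) (F : I -> 'rV[R]_d) u :
  dot u (\sum_(i | P i) F i) = \sum_(i | P i) dot u (F i).
Proof.
by apply: (big_morph (dot u) (dotDr u)); rewrite dotC dot0l.
Qed.

Lemma dot_ge0 u : 0 <= dot u u.
Proof. by apply: sumr_ge0 => j _; rewrite -expr2 sqr_ge0. Qed.

Lemma nrm_ge0 u : 0 <= nrm u.
Proof. exact: sqrtr_ge0. Qed.

Lemma nrm_sqr u : nrm u ^+ 2 = dot u u.
Proof. by rewrite sqr_sqrtr// dot_ge0. Qed.

Lemma nrm_sqrD u v : nrm (u + v) ^+ 2 = nrm u ^+ 2 + 2 * dot u v + nrm v ^+ 2.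
Proof. by rewrite !nrm_sqr dotDl !dotDr (dotC v u); ring. Qed.

Lemma nrmZ a u : nrm (a *: u) = `|a| * nrm u.
Proof.
by rewrite /nrm dotZl dotZr mulrA -expr2 sqrtrM ?sqr_ge0// sqrtr_sqr.
Qed.

Lemma nrm0 : nrm 0 = 0.
Proof. by rewrite /nrm dot0l sqrtr0. Qed.

Lemma nrm_eq0 u : (nrm u == 0) = (u == 0).
Proof.
apply/eqP/eqP => [u0|->]; last exact: nrm0.
have /eqP : dot u u = 0 by rewrite -nrm_sqr u0 expr0n.
rewrite psumr_eq0 => [/allP h|j _]; last by rewrite -expr2 sqr_ge0.
apply/rowP => j; rewrite mxE; have := h j (mem_index_enum j).
by rewrite mulf_eq0 orbb => /eqP.
Qed.

Lemma dot_le u v : `|dot u v| <= nrm u * nrm v.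
Proof.
have [/eqP|v0] := eqVneq (nrm v) 0.
  by rewrite nrm_eq0 => /eqP ->; rewrite dotC dot0l normr0 nrm0 mulr0.
have vp : 0 < nrm v ^+ 2 by rewrite exprn_gt0// lt_neqAle eq_sym v0 nrm_ge0.
rewrite -ler_sqr ?nnegrE ?mulr_ge0 ?nrm_ge0// real_normK ?num_real// exprMn.
(* This square expands to [nrm v ^+ 2] times the Cauchy-Schwarz gap. *)
have := dot_ge0 (nrm v ^+ 2 *: u + (- dot u v) *: v).
rewrite dotDl !dotDr !dotZl !dotZr (dotC v u) -!nrm_sqr.
move: (nrm u ^+ 2) (nrm v ^+ 2) (dot u v) vp => A B C Bp h.
by rewrite -subr_ge0 -(pmulr_rge0 _ Bp); lra.
Qed.

Lemma ler_nrmD u v : nrm (u + v) <= nrm u + nrm v.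
Proof.
rewrite -ler_sqr ?nnegrE ?addr_ge0 ?nrm_ge0// nrm_sqrD.
by have := dot_le u v; rewrite ler_norml => /andP[]; lra.
Qed.

Lemma edistE u v : edist u v = nrm (u - v).
Proof.
by congr Num.sqrt; apply: eq_bigr => j _; rewrite !mxE expr2.
Qed.

Lemma edistC u v : edist u v = edist v u.
Proof. by rewrite !edistE -opprB -scaleN1r nrmZ normrN1 mul1r. Qed.

Lemma edist_triangle u v w : edist u w <= edist u v + edist v w.
Proof.
by rewrite !edistE; have := ler_nrmD (u - v) (v - w); rewrite addrA subrK.
Qed.

Lemma edist_ge0 u v : 0 <= edist u v.
Proof. by rewrite edistE nrm_ge0. Qed.

Lemma nrm_sum_le (I : Type) (r : seq I) (P : pred I) (F : I -> 'rV[R]_d) D :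
  (forall i, P i -> nrm (F i) <= D) ->
  nrm (\sum_(i <- r | P i) F i) <= (count P r)%:R * D.
Proof.
move=> FD; elim: r => [|i r IH]; first by rewrite big_nil nrm0 mul0r.
rewrite big_cons /=; case: ifP => Pi; last by rewrite add0n.
rewrite natrD mulrDl mul1r; apply: (le_trans (ler_nrmD _ _)).
by apply: lerD => //; exact: FD.
Qed.

End EuclideanNorm.

(** * Sums over samples drawn with replacement *)

Lemma sum_tuple_cons (V : nmodType) (T : finType) (S : {set T}) n
    (F : n.+1.-tuple T -> V) :
  \sum_(Z : n.+1.-tuple T | all (mem S) Z) F Z =
  \sum_(x in S) \sum_(Z : n.-tuple T | all (mem S) Z) F (cons_tuple x Z).
Proof.
rewrite pair_big_dep /=.
rewrite (reindex (fun q : T * n.-tuple T => cons_tuple q.1 q.2)) /=.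
  by apply: eq_bigl.
exists (fun Z => (thead Z, behead_tuple Z)) => [[x Z] _|Z _].
  by congr (_, _); apply: val_inj.
by rewrite [RHS]tuple_eta.
Qed.

Lemma sum_tuple_const (R : pzSemiRingType) (T : finType) (S : {set T}) l (a : R) :
  \sum_(Z : l.-tuple T | all (mem S) Z) a = #|S|%:R ^+ l * a.
Proof.
elim: l => [|l IH].
  by rewrite (big_pred1 [tuple]) ?mul1r// => Z; rewrite tuple0 /= eqxx.
by rewrite sum_tuple_cons IH sumr_const exprS -[LHS]mulr_natl mulrA.
Qed.

(** * Cosh moments of sums of centered vectors *)

Section HilbertHoeffding.
Variables (R : realType) (d : nat) (T : finType).
Variables (S : {set T}) (P : pred T) (v : T -> 'rV[R]_d) (h : R).
Hypothesis v_le : forall x, P x -> nrm (v x) <= h.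
Hypothesis v_centered : \sum_(x in S | P x) v x = 0.

(* Since [|s + v|^2 <= |s|^2 + 2 <s, v> + h^2], the chord bound applies to every
   increment with the same [p = |s|] and [q = h], and its term linear in
   [<s, v>] averages out. *)
Lemma sum_cosh_nrm_le (s : 'rV[R]_d) :
  \sum_(x in S | P x) cosh (nrm (s + v x)) <=
  \sum_(x in S | P x) cosh (nrm s) * cosh h.
Proof.
have [K HK] := cosh_chord (nrm s) h.
apply: (@le_trans _ _
  (\sum_(x in S | P x) (cosh (nrm s) * cosh h + K * dot s (v x)))).
  apply: ler_sum => x /andP[_ Px].
  have vh := v_le Px; have v0 := nrm_ge0 (v x); have s0 := nrm_ge0 s.
  have h0 := le_trans v0 vh.
  have vh2 : nrm (v x) ^+ 2 <= h ^+ 2 by rewrite ler_sqr.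
  have sv := nrm_sqrD s (v x).
  have sv0 := sqr_ge0 (nrm (s + v x)).
  pose w := Num.sqrt (nrm s ^+ 2 + 2 * dot s (v x) + h ^+ 2).
  have w2 : w ^+ 2 = nrm s ^+ 2 + 2 * dot s (v x) + h ^+ 2.
    by rewrite sqr_sqrtr//; lra.
  apply: (@le_trans _ _ (cosh w)).
    apply: ler_cosh; rewrite ?nrm_ge0//.
    by rewrite -ler_sqr ?nnegrE ?nrm_ge0 ?sqrtr_ge0// w2; lra.
  by apply: HK => //; apply: (le_trans (dot_le _ _)); exact: ler_wpM2l.
rewrite big_split/= gerDl -[X in X <= 0]mulr_sumr -dot_sumr v_centered.
by rewrite dotC dot0l mulr0.
Qed.

(** A supermartingale: one division by [cosh h] per sample in [P] offsets its expected growth, and a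
    sample outside [P] changes nothing. The start [s] is arbitrary because the induction absorbs the
    first sample into it. *)
Lemma sum_tuple_cosh_nrm_le n (s : 'rV[R]_d) :
  \sum_(Z : n.-tuple T | all (mem S) Z)
     cosh (nrm (s + \sum_(x <- Z | P x) v x)) / cosh h ^+ count P Z <=
  #|S|%:R ^+ n * cosh (nrm s).
Proof.
have ch := cosh_gt0 h.
elim: n s => [|n IH] s.
  rewrite (big_pred1 [tuple]) => [|Z]; last by rewrite tuple0 /= eqxx.
  by rewrite big_nil addr0 expr0 /= divr1 mul1r.
rewrite sum_tuple_cons.
have step x : \sum_(Z : n.-tuple T | all (mem S) Z)
     cosh (nrm (s + \sum_(y <- cons_tuple x Z | P y) v y)) /
       cosh h ^+ count P (cons_tuple x Z) <=
   #|S|%:R ^+ n * (if P x then cosh (nrm (s + v x)) / cosh h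
                   else cosh (nrm s)).
  case: ifP => Px.
    apply: (@le_trans _ _ ((#|S|%:R ^+ n * cosh (nrm (s + v x))) / cosh h)).
      rewrite ler_pdivlMr// mulr_suml; apply: le_trans (IH (s + v x)).
      apply: ler_sum => Z _; rewrite big_cons /= Px add1n exprS addrA.
      by rewrite -mulrA ler_wpM2l ?cosh_ge0// invfM mulrAC mulVf ?gt_eqF// mul1r.
    by rewrite mulrA.
  apply: le_trans (IH s); apply: ler_sum => Z _.
  by rewrite big_cons /= Px add0n.
apply: (le_trans (ler_sum _ (fun x _ => step x))).
rewrite -mulr_sumr exprSr -mulrA ler_wpM2l ?exprn_ge0//.
rewrite (bigID P) /=.
apply: (@le_trans _ _ (\sum_(x in S | P x) cosh (nrm s) +
                       \sum_(x in S | ~~ P x) cosh (nrm s))).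
  apply: lerD; last first.
    by apply: ler_sum => x /andP[_ /negbTE ->].
  rewrite (eq_bigr (fun x => cosh (nrm (s + v x)) / cosh h)); last first.
    by move=> x /andP[_ ->].
  by rewrite -mulr_suml ler_pdivrMr// mulr_suml; exact: sum_cosh_nrm_le.
by rewrite -(bigID P) /= sumr_const mulr_natl.
Qed.

End HilbertHoeffding.

(** * Tail bound with a random number of summands *)

Section VectorTail.
Variables (R : realType) (d : nat) (T : finType).
Variables (S : {set T}) (P : pred T) (v : T -> 'rV[R]_d) (D t : R).
Hypothesis v_le : forall x, P x -> nrm (v x) <= D.
Hypothesis v_centered : \sum_(x in S | P x) v x = 0.

(* Markov's inequality for the cosh functional of the vectors scaled by
   [t / 4D]. *)
Lemma sum_tuple_tail_le n m : 0 <= D -> 0 < t ->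
  \sum_(Z : n.-tuple T | all (mem S) Z)
    ((m <= count P Z)%N &&
     ((count P Z)%:R * (t * D) < nrm (\sum_(x <- Z | P x) v x)))%:R <=
  #|S|%:R ^+ n * (2 * expR (- (m%:R * (t ^+ 2 / 8)))) :> R.
Proof.
(* For [D = 0] the scaling degenerates, but the counted vectors then vanish and the strict
   inequality fails. *)
rewrite le_eqVlt => /predU1P[D0|D0] t0.
  rewrite big1 => [|Z _].
    by rewrite mulr_ge0 ?exprn_ge0// mulr_ge0 ?expR_ge0.
  have : nrm (\sum_(x <- Z | P x) v x) <= (count P Z)%:R * D by exact: nrm_sum_le.
  by rewrite -D0 !mulr0 => h; rewrite ltNge h andbF.
pose c := t / (4 * D); pose h := t / 4.
have c0 : 0 < c by rewrite divr_gt0// mulr_gt0.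
have cD : c * D = h by rewrite /c /h; field; rewrite gt_eqF.
have cv_le x : P x -> nrm (c *: v x) <= h.
  by move=> Px; rewrite nrmZ gtr0_norm// -cD ler_pM2l// v_le.
have cv0 : \sum_(x in S | P x) c *: v x = 0.
  by rewrite -scaler_sumr v_centered scaler0.
have := sum_tuple_cosh_nrm_le cv_le cv0 n 0.
rewrite nrm0 cosh0 mulr1; set B := 2 * _ => H.
have B0 : 0 <= B by rewrite mulr_ge0 ?expR_ge0.
rewrite [leRHS]mulrC; apply: le_trans (ler_wpM2l B0 H).
rewrite mulr_sumr; apply: ler_sum => Z _.
set N := count P Z; rewrite -scaler_sumr add0r nrmZ gtr0_norm//.
case: andP => [[mN big]|_]; last first.
  by rewrite mulr_ge0// divr_ge0 ?exprn_ge0 ?cosh_ge0.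
have hN : 0 < cosh h ^+ N by rewrite exprn_gt0 ?cosh_gt0.
rewrite mulrA ler_pdivlMr// mul1r.
(* In the exponent each counted vector costs [t ^+ 2 / 8] through the normalizer and gains
   [t ^+ 2 / 4] on the event; the net gain is at least [m%:R * (t ^+ 2 / 8)]. *)
have h1 : cosh h ^+ N <= expR (N%:R * (t ^+ 2 / 8)).
  rewrite expRM_natl lerXn2r ?nnegrE ?cosh_ge0 ?expR_ge0//.
  by apply: (le_trans (cosh_le_expR_sqr _)); rewrite ler_expR /h; lra.
have h2 : expR (N%:R * (t ^+ 2 / 4)) <= 2 * cosh (c * nrm (\sum_(x <- Z | P x) v x)).
  have : N%:R * (t ^+ 2 / 4) <= c * nrm (\sum_(x <- Z | P x) v x).
    have -> : t ^+ 2 / 4 = c * (t * D) by rewrite /c; field; rewrite gt_eqF.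
    by rewrite mulrCA ler_pM2l// ltW.
  rewrite -ler_expR => /le_trans; apply.
  by have := expR_le_cosh (c * nrm (\sum_(x <- Z | P x) v x)); lra.
apply: (le_trans h1); rewrite /B [leRHS]mulrAC.
apply: le_trans (ler_wpM2r (expR_ge0 _) h2).
rewrite -expRD ler_expR.
have : m%:R * (t ^+ 2 / 8) <= N%:R * (t ^+ 2 / 8).
  by rewrite ler_wpM2r ?ler_nat// divr_ge0// sqr_ge0.
by lra.
Qed.

End VectorTail.

(** * Analysis of one round, then induction over the rounds *)

Section Rounds.
Variables (R : realType) (d : nat) (T : finType) (pts : T -> 'rV[R]_d).
Variables (k : nat) (cl : T -> 'I_k) (gamma : R).
Hypothesis cluster_neq0 : forall i, exists x, cl x = i.
Hypothesis margin : gamma_margin pts cl gamma (com pts cl).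
Hypothesis gamma_gt1 : 1 < gamma.

Let mu := com pts cl.

Definition plurality l (Z : l.+1.-tuple T) : 'I_k :=
  [arg max_(t > cl (tnth Z ord0)) count (fun x => cl x == t) Z]%O.

Definition sample_mean l (Z : l.+1.-tuple T) (p : 'I_k) : 'rV[R]_d :=
  ((count (fun x => cl x == p) Z)%:R)^-1 *: \sum_(x <- Z | cl x == p) pts x.

Lemma count_plurality l (Z : l.+1.-tuple T) (t : 'I_k) :
  (count (fun x => cl x == t) Z <= count (fun x => cl x == plurality Z) Z)%N.
Proof. by rewrite /plurality; case: arg_maxP => // i _; apply. Qed.

Lemma sum_count_label (s : seq T) :
  (\sum_(t < k) count (fun x => cl x == t) s = size s)%N.
Proof.
elim: s => [|x s IH]; first by rewrite big1.
rewrite big_split /= IH -add1n; congr addn.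
rewrite (bigD1 (cl x))//= eqxx big1 ?addn0// => i ix.
by rewrite eq_sym (negbTE ix).
Qed.

Lemma plurality_pigeonhole eta (Z : (k * eta).+1.-tuple T) :
  (eta < count (fun x => cl x == plurality Z) Z)%N.
Proof.
rewrite ltnNge; apply/negP => h.
have : ((k * eta).+1 <= k * eta)%N; last by rewrite ltnn.
rewrite -{1}(size_tuple Z) -sum_count_label.
apply: (@leq_trans (\sum_(t < k) eta)); last by rewrite sum_nat_const card_ord.
by apply: leq_sum => t _; exact: leq_trans (count_plurality Z t) h.
Qed.

(** Makes the sample mean well defined even when [eta] is 0, and shows that the chosen cluster has
    not been output before. *)
Lemma plurality_mem l (Z : l.+1.-tuple T) :
  exists2 x, x \in Z & cl x = plurality Z.
Proof.
have : has (fun x => cl x == plurality Z) Z.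
  rewrite has_count; apply: leq_trans (count_plurality Z (cl (tnth Z ord0))).
  by rewrite -has_count; apply/hasP; exists (tnth Z ord0); rewrite ?mem_tnth.
by case/hasP => x xZ /eqP; exists x.
Qed.

(** The radius is attained at a point of the cluster, and the margin property at that point bounds
    all the others. *)
Lemma margin_radius (p : 'I_k) : exists D : R, [/\ 0 <= D,
  forall x, cl x = p -> edist (pts x) (mu p) <= D &
  forall y, cl y != p -> gamma * D < edist (pts y) (mu p)].
Proof.
have [x0 /eqP x0p] := cluster_neq0 p.
pose F x := edist (pts x) (mu p).
case: (@arg_maxP _ R _ x0 (fun x => cl x == p) F x0p) => x /eqP xp xmax.
exists (F x); split; first exact: edist_ge0.
  by move=> y /eqP yp; exact: xmax.
by move=> y yp; exact: margin xp yp.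
Qed.

Lemma one_step_some l (S : {set T}) (Z : l.+1.-tuple T) :
  (forall y, cl y = plurality Z) \/
  (exists D, [/\
    forall x, cl x = plurality Z -> edist (pts x) (mu (plurality Z)) <= D,
    forall y, cl y != plurality Z -> gamma * D < edist (pts y) (mu (plurality Z)) &
    edist (sample_mean Z (plurality Z)) (mu (plurality Z)) <=
      (gamma - 1) / 2 * D]) ->
  one_step pts cl S Z = Some [set x in S | cl x == plurality Z].
Proof.
move=> H; rewrite /one_step -/(plurality Z) -/(sample_mean Z (plurality Z)).
move: (plurality Z) H => p H; rewrite asboolT//.
case: H => [clp|[D [inD outD mm]]].
  have [E|/set0Pn[x0 x0S]] := eqVneq S set0.
    by exists 0; apply/setP => x; rewrite !inE E inE.
  exists (edist (pts [arg max_(x > x0) edist (pts x) (sample_mean Z p)]%O)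
    (sample_mean Z p)).
  apply/setP => x; rewrite !inE clp eqxx; congr andb.
  by case: arg_maxP => // i _ /(_ x isT) ix; apply/esym; exact: ix.
(* With [e] the error of the mean, outside points are farther than [gamma * D - e], which is at
   least [D + e] because [e <= (gamma - 1) / 2 * D]. *)
exists (D + edist (sample_mean Z p) (mu p)); apply/setP => x; rewrite !inE.
congr andb; apply/esym; have [/eqP xp|xp] := boolP (cl x == p).
  apply: (le_trans (edist_triangle _ (mu p) _)).
  by rewrite (edistC (mu p)) lerD2r inD.
apply/negbTE; rewrite -ltNge.
have := outD x xp; have := edist_triangle (pts x) (sample_mean Z p) (mu p).
lra.
Qed.

Lemma sample_mean_sub l (Z : l.+1.-tuple T) p :
  (0 < count (fun x => cl x == p) Z)%N ->
  (count (fun x => cl x == p) Z)%:R * edist (sample_mean Z p) (mu p) =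
  nrm (\sum_(x <- Z | cl x == p) (pts x - mu p)).
Proof.
move=> c0; have c1 : (count (fun x => cl x == p) Z)%:R != 0 :> R.
  by rewrite pnatr_eq0 -lt0n.
rewrite edistE -[X in X * _]normr_nat -nrmZ; congr nrm.
rewrite scalerBr scalerA mulfV// scale1r sumrB; congr (_ - _).
by rewrite big_const_seq iter_addr_0 scaler_nat.
Qed.

(** Samples come from [S], not from the cluster: the sum is either the full one around the center of
    mass or empty. *)
Lemma sum_centered (S : {set T}) p :
  (cluster cl p \subset S) || [disjoint cluster cl p & S] ->
  \sum_(x in S | cl x == p) (pts x - mu p) = 0.
Proof.
case/orP => [/subsetP sub|dis]; last first.
  apply: big_pred0 => x; apply/negP => /andP[xS xp].
  by move/disjointFr: dis => /(_ x); rewrite inE xp xS => /(_ isT).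
rewrite (eq_bigl [in cluster cl p]) => [|x]; last first.
  by have := sub x; rewrite inE; case: (cl x == p) => [->|]; rewrite ?andbT ?andbF.
rewrite sumrB sumr_const -scaler_nat /mu /com scalerA mulfV ?scale1r ?subrr//.
rewrite pnatr_eq0 -lt0n; apply/card_gt0P.
by have [x <-] := cluster_neq0 p; exists x; rewrite inE.
Qed.

(** A mean of points within [D] of the center is itself within [D], and here
    [(gamma - 1) / 2 >= 1]. *)
Lemma one_step_some_wide l (S : {set T}) (Z : l.+1.-tuple T) :
  3 <= gamma ->
  one_step pts cl S Z = Some [set x in S | cl x == plurality Z].
Proof.
move=> g3; apply: one_step_some; right.
have [D [D0 inD outD]] := margin_radius (plurality Z).
exists D; split => //.
have c0 : (0 < count (fun x => cl x == plurality Z) Z)%N.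
  have [x xZ xp] := plurality_mem Z.
  by rewrite -has_count; apply/hasP; exists x => //; rewrite xp.
apply: (@le_trans _ _ D); last by rewrite ler_peMl//; lra.
rewrite -(@ler_pM2l _ (count (fun x => cl x == plurality Z) Z)%:R) ?ltr0n//.
rewrite sample_mean_sub//; apply: nrm_sum_le => x /eqP xp.
by rewrite -edistE inD.
Qed.

Lemma one_step_none_le eta (S : {set T}) :
  (forall p, (cluster cl p \subset S) || [disjoint cluster cl p & S]) ->
  \sum_(Z : (k * eta).+1.-tuple T | all (mem S) Z)
    (one_step pts cl S Z == None)%:R <=
  #|S|%:R ^+ (k * eta).+1 *
    (k%:R * (2 * expR (- (eta%:R * (((gamma - 1) / 2) ^+ 2 / 8))))) :> R.
Proof.
move=> Ssat; have [D DP] := fin_all_exists margin_radius.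
have t0 : 0 < (gamma - 1) / 2 by rewrite divr_gt0// subr_gt0.
have v_le p x : cl x == p -> nrm (pts x - mu p) <= D p.
  by rewrite -edistE => /eqP xp; case: (DP p) => _ + _; apply.
have D_ge0 p : 0 <= D p by case: (DP p).
apply: (@le_trans _ _ (\sum_(p < k)
    #|S|%:R ^+ (k * eta).+1 * (2 * expR (- (eta%:R * (((gamma - 1) / 2) ^+ 2 / 8)))))).
  apply: le_trans; last first.
    apply: ler_sum => p _.
    exact: sum_tuple_tail_le (v_le p) (sum_centered (Ssat p)) _ _ (D_ge0 p) t0.
  rewrite exchange_big /=; apply: ler_sum => Z _.
  case: eqP => // none; last by apply: sumr_ge0.
  (* Among the tail events of all labels, the one of the plurality label must occur when the round
     fails. *)
  rewrite (bigD1 (plurality Z))//= ler_wpDr ?sumr_ge0//.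
  have big := plurality_pigeonhole Z.
  rewrite (ltnW big) /= ltNge; case: (boolP (nrm _ <= _)) => // small; exfalso.
  move: none; rewrite one_step_some//; right.
  have [D0 inD outD] := DP (plurality Z).
  exists (D (plurality Z)); split => //.
  have c0 : (0 < count (fun x => cl x == plurality Z) Z)%N by case: (count _ _) big.
  rewrite -(@ler_pM2l _ (count (fun x => cl x == plurality Z) Z)%:R) ?ltr0n//.
  by rewrite sample_mean_sub.
by rewrite big_const_ord iter_addr_0 -[leLHS]mulr_natl mulrCA.
Qed.

(** [A] collects the labels already output. *)
Definition remaining (A : {set 'I_k}) : {set T} := [set x | cl x \notin A].

Lemma remaining_saturated A p :
  (cluster cl p \subset remaining A) || [disjoint cluster cl p & remaining A].
Proof.
have [pA|pA] := boolP (p \in A); apply/orP; [right|left].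
  rewrite disjoint_subset; apply/subsetP => x; rewrite !inE => /eqP ->.
  by rewrite pA.
by apply/subsetP => x; rewrite !inE => /eqP ->.
Qed.

(** Union bound over the rounds: after successful rounds the state is determined by [A], so one
    bound [q] for all [A] suffices. *)
Lemma success_prob_ge l (q : R) : 0 <= q -> k%:R * q <= 1 ->
  (forall A, \sum_(Z : l.+1.-tuple T | all (mem (remaining A)) Z)
     (one_step pts cl (remaining A) Z == None)%:R <=
     #|remaining A|%:R ^+ l.+1 * q) ->
  (forall S (Z : l.+1.-tuple T), one_step pts cl S Z = None \/
     one_step pts cl S Z = Some [set x in S | cl x == plurality Z]) ->
  forall n A, #|~: A| = n ->
  1 - n%:R * q <= success_prob pts cl l n (remaining A) [set cluster cl i | i in A].
Proof.
move=> q0 kq fail_le stepE; elim=> [|n IH] A An.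
  have -> : A = setT by rewrite -[A]setCK (cards0_eq An) setC0.
  rewrite /= mul0r subr0 (_ : _ == target cl)//.
  by apply/eqP/setP => B; apply/imsetP/imsetP => -[i _ ->]; exists i; rewrite ?inE.
have /card_gt0P[i iA] : (0 < #|~: A|)%N by rewrite An.
have [x0 x0i] := cluster_neq0 i.
have Sx0 : x0 \in remaining A by rewrite inE x0i -in_setC.
have S0 : 0 < #|remaining A|%:R ^+ l.+1 :> R.
  by rewrite exprn_gt0// ltr0n; apply/card_gt0P; exists x0.
have nk : n.+1%:R * q <= 1.
  apply: le_trans kq; rewrite ler_wpM2r// ler_nat -An.
  by rewrite -[X in (_ <= X)%N]card_ord max_card.
have nE : n.+1%:R * q = n%:R * q + q by rewrite -natr1 mulrDl mul1r.
rewrite nE in nk *.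
rewrite /= ifF; last by apply/negbTE/set0Pn; exists x0.
rewrite [leRHS]mulrC ler_pdivlMr// [leLHS]mulrC.
(* Charging 1 to each failing sample makes its summand at most 0, its true contribution. *)
apply: (@le_trans _ _ (\sum_(Z : l.+1.-tuple T | all (mem (remaining A)) Z)
   ((1 - n%:R * q) - (one_step pts cl (remaining A) Z == None)%:R))).
  rewrite sumrB sum_tuple_const opprD addrA mulrBr lerD2l lerN2.
  exact: fail_le.
apply: ler_sum => Z ZS; case: (stepE (remaining A) Z) => ->.
  have : 0 <= n%:R * q by rewrite mulr_ge0.
  by rewrite eqxx /= mulr1n; lra.
rewrite /= subr0; set p := plurality Z.
have pA : p \notin A.
  have [x xZ xp] := plurality_mem Z.
  by have := allP ZS x xZ; rewrite /= inE xp.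
have -> : [set x in remaining A | cl x == p] = cluster cl p.
  by apply/setP => x; rewrite !inE; case: eqP => [->|]; rewrite ?pA ?andbF.
have -> : remaining A :\: cluster cl p = remaining (p |: A).
  by apply/setP => x; rewrite !inE negb_or.
rewrite -imsetU1; apply: IH.
apply/eqP; rewrite -(eqn_add2l #|p |: A|) cardsC cardsU1 pA add1n addSnnS -An.
by rewrite cardsC.
Qed.

End Rounds.

(** * Sample size and the failure budget [delta / k] of a round *)

Lemma eta_nat_tail (R : realType) (gamma delta : R) (k : nat) :
  (1 < k)%N -> 0 < delta < 1 -> 1 < gamma -> gamma <= 3 ->
  k%:R * (2 * expR (- ((eta_nat 384 gamma delta k)%:R *
                      (((gamma - 1) / 2) ^+ 2 / 8)))) <= delta / k%:R.
Proof.
move=> k1 /andP[d0 d1] g1 g3.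
have k0 : 0 < k%:R :> R by rewrite ltr0n; apply: ltn_trans k1.
have k2 : 2 <= k%:R :> R by rewrite ler_nat.
have dV0 : 0 < delta^-1 by rewrite invr_gt0.
set L := ln k%:R + ln delta^-1.
have LE : expR (- L) = delta / k%:R.
  by rewrite /L opprD expRD !expRN !lnK ?posrE// invrK mulrC.
have L0 : 0 <= L.
  by rewrite addr_ge0// ln_ge0//; [lra|rewrite invf_ge1// ltW].
set g := gamma - 1; have g0 : 0 < g by rewrite /g; lra.
have g2 : g <= 2 by rewrite /g; lra.
have etaE : 384 * L / g ^+ 4 <= (eta_nat 384 gamma delta k)%:R.
  apply: (le_trans (ceil_ge _)); rewrite /eta_nat -/L -/g.
  by rewrite natr_absz ler_int ler_norm.
(* [384 / 32 = 12], and [g <= 2] turns [12 * L / g ^+ 2] into at least [3 * L]. The cube of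
   [delta / k] pays for the [k] labels and the factor 2. *)
have main : 3 * L <= (eta_nat 384 gamma delta k)%:R * ((g / 2) ^+ 2 / 8).
  have gg : 0 <= (g / 2) ^+ 2 / 8 by rewrite divr_ge0// sqr_ge0.
  apply: le_trans (ler_wpM2r gg etaE).
  have -> : 384 * L / g ^+ 4 * ((g / 2) ^+ 2 / 8) = 12 * L / g ^+ 2.
    by field; rewrite gt_eqF.
  rewrite ler_pdivlMr ?exprn_gt0//.
  have : g ^+ 2 <= 4 by nra.
  by nra.
have E : expR (- ((eta_nat 384 gamma delta k)%:R * ((g / 2) ^+ 2 / 8))) <=
    (delta / k%:R) ^+ 3.
  by rewrite -LE -expRM_natl ler_expR; lra.
apply: (@le_trans _ _ (k%:R * (2 * (delta / k%:R) ^+ 3))).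
  by rewrite ler_pM2l// ler_pM2l.
have -> : k%:R * (2 * (delta / k%:R) ^+ 3) = 2 * delta ^+ 2 / k%:R * (delta / k%:R).
  by field; rewrite gt_eqF.
rewrite ler_piMl//; first by rewrite divr_ge0 ?ltW.
rewrite ler_pdivrMr// mul1r.
nra.
Qed.

Theorem theorem1 (R : realType) :
  exists beta : R, 0 < beta /\
  forall (d : nat) (T : finType) (pts : T -> 'rV[R]_d) (k : nat) (cl : T -> 'I_k)
         (gamma delta : R),
    injective pts ->
    (forall i : 'I_k, exists x : T, cl x = i) ->
    center_based pts cl (com pts cl) ->
    gamma_margin pts cl gamma (com pts cl) ->
    0 < delta < 1 -> 1 < gamma ->
    1 - delta <= algo_success_prob pts cl beta gamma delta.
Proof.
exists 384; split; first by [].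
move=> d T pts k cl gamma delta _ cl_surj _ margin d01 g1.
have /andP[d0 d1] := d01.
rewrite /algo_success_prob; set eta := eta_nat _ _ _ _.
have -> : [set: T] = remaining cl set0 by apply/setP => x; rewrite !inE.
have -> : set0 = [set cluster cl i | i in set0] :> {set {set T}}.
  by rewrite imset0.
have kq : k%:R * (delta / k%:R) <= delta.
  have [->|k0] := eqVneq (k%:R : R) 0; first by rewrite mul0r ltW.
  by rewrite mulrC divfK.
have q0 : 0 <= delta / k%:R by rewrite divr_ge0// ltW.
apply: (@le_trans _ _ (1 - k%:R * (delta / k%:R))); first by rewrite lerD2l lerN2.
apply: success_prob_ge => //; first by lra.
(* With at most one label any large radius works; [gamma >= 3] is split off next because
   [eta_nat_tail] assumes [gamma <= 3]. *)
- move=> A; have [k1|k1] := leqP k 1.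
    rewrite big1 => [|Z _]; first exact: mulr_ge0 (exprn_ge0 _ (ler0n _ _)) q0.
    rewrite (@one_step_some _ _ _ _ _ _ gamma)//; left => y; apply: ord_inj.
    have ord_0 (i : 'I_k) : i = 0%N :> nat.
      by apply/eqP; rewrite -leqn0 -ltnS (leq_trans (ltn_ord i)).
    by rewrite !ord_0.
  have [g3|/ltW g3] := leP 3 gamma.
    rewrite big1 => [|Z _]; first exact: mulr_ge0 (exprn_ge0 _ (ler0n _ _)) q0.
    by rewrite (one_step_some_wide cl_surj margin).
  apply: (le_trans (one_step_none_le cl_surj margin g1 eta (remaining_saturated cl A))).
  by rewrite ler_wpM2l ?exprn_ge0//; exact: eta_nat_tail.
- by move=> S Z; rewrite /one_step; case: asbool; [right|left].
- by rewrite setC0 cardsT card_ord.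
Qed.
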